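(* Let $m\geq 4$ be even, $n=2^m-1$, and let $i_1,i_2\in\{0,1,2,3\}$ with $i_1-i_2\equiv 1 \pmod 2$. Let $\mathcal{C}=\mathcal{C}_{i_1,i_2}$ be the binary $[n,n-m-1,3]$ code with parity check matrix $H_m(\mathbf{v}_{i_1,i_2})$ (defined in the context). Then the automorphism group $\mathrm{Aut}(\mathcal{C})$ is isomorphic to the symplectic group $Sp(m,2)$, and its order is \[ |\mathrm{Aut}(\mathcal{C})| = (2^m-1)\cdot 2^{m-1}\cdot (2^{m-2}-1)\cdot 2^{m-3}\cdots (2^2-1)\cdot 2 \;=\;\prod_{j=1}^{m/2}(2^{2j}-1)\,2^{2j-1}. \]
   Context: $\mathbb{F}_2$ is the binary field. Let $m\ge 4$ be even and $n=2^m-1$. Let $\alpha$ be a primitive element of $GF(2^m)$ and let $H_m$ be the $m\times n$ binary matrix whose $i$-th column $\mathbf{h}_i$ ($i=0,\dots,n-1$) is the coordinate vector of $\alpha^i$ with respect to the basis $1,\alpha,\dots,\alpha^{m-1}$; thus the columns of $H_m$ are exactly the nonzero vectors of $\mathbb{F}_2^m$, and $H_m$ is a parity check matrix of the binary Hamming code $\mathcal{H}_m$. For distinct $i_1,i_2\in\{0,1,2,3\}$ let $\mathbf{v}_{i_1,i_2}=(v_0,\dots,v_{n-1})$ where $v_i=1$ if the Hamming weight $\mathrm{wt}(\mathbf{h}_i)\equiv i_1$ or $i_2 \pmod 4$, and $v_i=0$ otherwise. $H_m(\mathbf{v}_{i_1,i_2})$ is the $(m+1)\times n$ matrix obtained from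 $H_m$ by appending the row $\mathbf{v}_{i_1,i_2}$, and $\mathcal{C}_{i_1,i_2}=\{\mathbf{c}\in\mathbb{F}_2^n: H_m(\mathbf{v}_{i_1,i_2})\mathbf{c}^T=\mathbf{0}\}$. The automorphism group $\mathrm{Aut}(\mathcal{C})$ of a binary code $\mathcal{C}$ of length $n$ is the group of permutations of the $n$ coordinate positions mapping $\mathcal{C}$ into itself. $Sp(m,2)$ is the group of nonsingular $m\times m$ binary matrices preserving a nondegenerate alternating (symplectic) bilinear form on $\mathbb{F}_2^m$. *)

(* Defs.v *)
From HB Require Import structures.
From mathcomp Require Import all_boot all_order all_algebra all_fingroup all_field.

Set Implicit Arguments.
Unset Strict Implicit.
Unset Printing Implicit Defensive.

Import GRing.Theory.
Local Open Scope ring_scope.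

Definition wt (k : nat) (x : 'rV['F_2]_k) : nat := #|[set j | x 0 j != 0]|.

(* For alpha primitive in F with \dim {:F} = m, the powers of alpha below m    *)
(* form a basis of F over 'F_2, so [coord] gives the actual coordinates.       *)
Definition Hm (m n : nat) (F : fieldExtType 'F_2) (alpha : F) :
    'M['F_2]_(m, n) :=
  \matrix_(j < m, i < n) coord [tuple alpha ^+ k | k < m] j (alpha ^+ i).

Definition vvec (m n : nat) (H : 'M['F_2]_(m, n)) (i1 i2 : 'I_4) :
    'rV['F_2]_n :=
  \row_i (let w := wt (col i H)^T in
          (w == i1 %[mod 4]) || (w == i2 %[mod 4]))%N%:R.

Definition Hmv (m n : nat) (F : fieldExtType 'F_2) (alpha : F) (i1 i2 : 'I_4) :
    'M['F_2]_(m + 1, n) :=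
  col_mx (Hm m n alpha) (vvec (Hm m n alpha) i1 i2).

Definition code_of (r n : nat) (H : 'M['F_2]_(r, n)) : {set 'rV['F_2]_n} :=
  [set c | H *m c^T == 0].

Definition min_distance (n : nat) (C : {set 'rV['F_2]_n}) (d : nat) : Prop :=
  (exists x y, [/\ x \in C, y \in C, x != y & wt (x - y) = d]) /\
  (forall x y, x \in C -> y \in C -> x != y -> d <= wt (x - y))%N.

Definition linear_code (n k d : nat) (C : {set 'rV['F_2]_n}) : Prop :=
  exists V : {vspace 'rV['F_2]_n},
    [/\ C = [set c | c \in V], \dim V = k & min_distance C d].

Section CodeAut.
Variables (n : nat) (C : {set 'rV['F_2]_n}).

Definition code_Aut : {set 'S_n} :=
  [set s : 'S_n | [forall c in C, col_perm s c \in C]].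

Lemma code_Aut_group_set : group_set code_Aut.
Proof.
apply/group_setP; split=> [|s t].
  by rewrite inE; apply/forall_inP=> c Cc; rewrite col_perm1.
rewrite !inE => /forall_inP Cs /forall_inP Ct.
by apply/forall_inP=> c Cc; rewrite col_permM Cs ?Ct.
Qed.

Canonical code_Aut_group := Group code_Aut_group_set.
End CodeAut.

(* As for {'GL_m[_]}, vectors have length m.-1.+1, which is m as soon as m > 0. *)
Section Symplectic.
Variables (m : nat) (B : {skew_symmetric 'rV['F_2]_m.-1.+1}).

Definition Sp : {set {'GL_m['F_2]}} :=
  [set g : {'GL_m['F_2]} |
    [forall u, forall v, B (u *m GLval g) (v *m GLval g) == B u v]].

Lemma Sp_group_set : group_set Sp.
Proof.
apply/group_setP; split=> [|g h].
  by rewrite inE; apply/forallP=> u; apply/forallP=> v; rewrite !mulmx1.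
rewrite !inE => /forallP Bg /forallP Bh; apply/forallP=> u; apply/forallP=> v.
rewrite GL_MxE !mulmxA.
by rewrite (eqP (forallP (Bh _) _)) (eqP (forallP (Bg _) _)).
Qed.

Canonical Sp_group := Group Sp_group_set.
End Symplectic.

(* Main.v *)
(* The weight of a binary vector x mod 4 has parity e1(x) and second bit e2(x),
   where e1, e2 are elementary symmetric polynomials, so for i1 - i2 odd the
   last parity row is f(h_i), with f a quadratic function equal to e2 up to an
   affine one.  The polarization of f is the alternating form with matrix J + I
   (J all ones), which is invertible because m is even.  A coordinate
   permutation fixes the code iff it fixes the dual code, i.e. the space
   spanned by the linear functions and f on the nonzero vectors.  Since
   (sum_x (-1)^(f(x) + l(x)))^2 = 2^m for every linear l, while the sum of a
   nontrivial linear character vanishes, such a permutation maps linear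
   functions to linear functions: it is induced by some g in GL_m, and f o g - f
   is linear exactly when g preserves the polarization.  Counting the symplectic
   bases of an arbitrary nondegenerate alternating form shows at once that all
   such forms are congruent and gives the order of their isometry groups. *)
Require Import Defs.
From HB Require Import structures.
From mathcomp Require Import all_boot all_order all_algebra all_fingroup all_field.
From mathcomp Require Import zify ring.

Set Implicit Arguments.
Unset Strict Implicit.
Unset Printing Implicit Defensive.

Import GRing.Theory.
Local Open Scope ring_scope.

(** * Numbers of solutions of linear systems over a finite field *)

Section LinearCounting.
Variable F : finFieldType.

Lemma card_ker_mulmx m r (A : 'M[F]_(m, r)) :
  #|[set v : 'rV[F]_m | v *m A == 0]| = (#|F| ^ (m - \rank A))%N.
Proof.
rewrite -mxrank_ker -[\rank _]mul1n -card_mx.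
rewrite -(@card_imset _ _ (fun w : 'rV_(\rank (kermx A)) => w *m row_base (kermx A)));
  last by apply: row_free_inj; exact: row_base_free.
apply: eq_card => v; rewrite inE; apply/idP/imsetP.
  move/eqP/sub_kermxP; rewrite -(eq_row_base (kermx A)) => /submxP[w ->].
  by exists w.
case=> w _ ->; apply/eqP/sub_kermxP; apply: (submx_trans (submxMl _ _)).
by rewrite eq_row_base.
Qed.

(** Full column rank gives a particular solution, and the solution set is its translate of the
    kernel. *)
Lemma card_affine_mulmx m r (A : 'M[F]_(m, r)) (c : 'rV[F]_r) :
  \rank A = r -> #|[set v : 'rV[F]_m | v *m A == c]| = (#|F| ^ (m - r))%N.
Proof.
move=> rA; have /submxP[v0 ->]: (c <= A)%MS.
  by rewrite submx_full // /row_full rA.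
rewrite -[in RHS]rA -card_ker_mulmx -[RHS](card_imset _ (addIr v0)).
apply: eq_card => v; rewrite inE; apply/idP/imsetP => [/eqP e|[w]].
  exists (v - v0); last by rewrite subrK.
  by rewrite inE mulmxBl e subrr.
by rewrite inE => /eqP e ->; rewrite mulmxDl e add0r.
Qed.

End LinearCounting.

(** * Counting partial symplectic bases of an alternating form *)

Section SymplecticBases.
Variable F : finFieldType.

Definition hyperbolic_mx : 'M[F]_2 := block_mx (0 : 'M_1) 1%:M (- 1%:M) (0 : 'M_1).

(** The basis is ordered by hyperbolic pairs, so that a new pair is stacked on top of a shorter
    frame; [k.+1.*2] and [2 + k.*2] are convertible. *)
Fixpoint std_symp_mx k : 'M[F]_(k.*2) :=
  if k is k'.+1 return 'M[F]_(k.*2)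
  then block_mx hyperbolic_mx 0 0 (std_symp_mx k') : 'M_(2 + k'.*2)
  else 0.

Lemma std_symp_mx_unit k : std_symp_mx k \in unitmx.
Proof.
elim: k => [|k IH]; first by rewrite unitmxE det_mx00 unitr1.
rewrite /= unitmxE (@det_ublock _ 2) unitrM -!unitmxE IH andbT.
suff /mulmx1_unit[] : hyperbolic_mx *m - hyperbolic_mx = 1%:M by [].
rewrite mulmxN /hyperbolic_mx (@mulmx_block _ 1 1 1 1 1 1).
rewrite !(mul0mx, mulmx0, mul1mx, mulmx1, add0r, addr0, mulNmx, oppr0).
by rewrite (@opp_block_mx _ 1 1 1 1) !opprK !oppr0 -scalar_mx_block.
Qed.

Variables (m : nat) (J : 'M[F]_m).
Hypothesis altJ : forall x : 'rV_m, x *m J *m x^T = 0.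
Hypothesis unitJ : J \in unitmx.

Lemma alternating_skew (x y : 'rV_m) : y *m J *m x^T = - (x *m J *m y^T).
Proof.
have := altJ (x + y); rewrite linearD !mulmxDl !mulmxDr !altJ add0r addr0 addrC.
by move/eqP; rewrite addr_eq0 => /eqP.
Qed.

Lemma alternating_skew_mx : J^T = - J.
Proof.
apply/matrixP=> i j; rewrite !mxE.
have := alternating_skew (delta_mx 0 i) (delta_mx 0 j).
by rewrite -!rowE !trmx_delta -!colE => /matrixP/(_ 0 0); rewrite !mxE.
Qed.

Definition symp_frames k : {set 'M[F]_(k.*2, m)} :=
  [set U | U *m J *m U^T == std_symp_mx k].

(** The hyperbolic pairs in the orthogonal of the row space of [U]: the ways to extend [U] by one
    pair. *)
Definition hyperbolic_pairs k (U : 'M[F]_(k.*2, m)) : {set 'rV[F]_m * 'rV[F]_m} :=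
  [set uv | [&& uv.1 *m J *m U^T == 0, uv.2 *m J *m U^T == 0
              & uv.1 *m J *m (uv.2)^T == 1%:M]].

Lemma skew_gram r s (U : 'M[F]_(r, m)) (V : 'M[F]_(s, m)) :
  (U *m J *m V^T)^T = - (V *m J *m U^T).
Proof. by rewrite !trmx_mul trmxK alternating_skew_mx mulNmx mulmxN mulmxA. Qed.

(** In the block Gram matrix the diagonal entries of the new pair vanish because the form is
    alternating, and skewness recovers the blocks below the diagonal from those above. *)
Lemma symp_framesS k (u v : 'rV_m) (U : 'M[F]_(k.*2, m)) :
  (col_mx (col_mx u v) U : 'M_(k.+1.*2, m)) \in symp_frames k.+1 =
  (U \in symp_frames k) && ((u, v) \in hyperbolic_pairs U).
Proof.
pose X := col_mx (col_mx u v) U.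
transitivity (X *m J *m X^T ==
  block_mx (block_mx 0 1%:M (- 1%:M) 0) 0 0 (std_symp_mx k)); first by rewrite inE.
rewrite !inE /= /X tr_col_mx mul_col_mx mul_col_row.
rewrite tr_col_mx mul_col_mx mul_col_row mul_col_mx mul_mx_row !altJ.
rewrite (alternating_skew u v).
apply/eqP/andP.
  case/eq_block_mx=> /eq_block_mx[_ e1 _ _] e2 _ ->.
  move/eqP: e2; rewrite col_mx_eq0 => /andP[-> ->]; by rewrite e1 !eqxx.
case=> /eqP -> /and3P[/eqP e1 /eqP e2 /eqP e3].
rewrite e1 e2 e3 col_mx0.
suff -> : row_mx (U *m J *m u^T) (U *m J *m v^T) = 0 by [].
rewrite -[U *m J *m u^T]opprK -[U *m J *m v^T]opprK -!skew_gram e1 e2.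
by rewrite !trmx0 !oppr0 row_mx0.
Qed.

(** The vector [u] runs over the nonzero vectors of the orthogonal of [U], of dimension [m - k.*2];
    each such [u] leaves [k.*2 + 1] independent affine conditions on [v]. *)
Lemma card_hyperbolic_pairs k (U : 'M[F]_(k.*2, m)) : U \in symp_frames k ->
  #|hyperbolic_pairs U| =
  ((#|F| ^ (m - k.*2) - 1) * #|F| ^ (m - k.*2).-1)%N.
Proof.
rewrite inE => /eqP gramU.
have rankM r (W : 'M_(r, m)) : row_free W -> \rank (J *m W^T) = r.
  by rewrite /row_free => /eqP rW; rewrite eqmxMfull ?row_full_unit ?mxrank_tr //.
(* The Gram matrix of [U] is invertible, so only the zero combination of its rows is orthogonal to
   all of them. *)
have perpU w : w *m U *m J *m U^T = 0 -> w = 0 :> 'rV_(k.*2).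
  rewrite -2!mulmxA [U *m _]mulmxA gramU => /(congr1 (mulmx^~ (invmx (std_symp_mx k)))).
  by rewrite mulmxK ?std_symp_mx_unit // mul0mx.
have freeU : row_free U.
  by apply: inj_row_free => w wU; apply: perpU; rewrite wU !mul0mx.
pose P := [set u : 'rV_m | u *m (J *m U^T) == 0].
have cardP : #|P| = (#|F| ^ (m - k.*2))%N by rewrite card_ker_mulmx rankM.
have cardV u : u \in P :\ 0 ->
  #|[set v | (u, v) \in hyperbolic_pairs U]| = (#|F| ^ (m - k.*2).-1)%N.
  rewrite !inE => /andP[u0 /eqP uP].
  have free_uU : row_free (col_mx U u).
    apply: inj_row_free => w; rewrite -[w]hsubmxK mul_row_col => e.
    have w1 : lsubmx w = 0.
      apply: perpU; move/(congr1 (mulmx^~ (J *m U^T))): e.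
      by rewrite mulmxDl -[_ *m u *m _]mulmxA uP mulmx0 addr0 mul0mx mulmxA.
    rewrite w1; move: e; rewrite w1 mul0mx add0r [rsubmx w]mx11_scalar mul_scalar_mx.
    by move/eqP; rewrite scaler_eq0 (negPf u0) orbF => /eqP->; rewrite raddf0 row_mx0.
  rewrite -subn1 -subnDA.
  (* The conditions on [v] form one affine system; the entry [-1] is the requirement [u J v^T = 1]
     read with [v] on the left. *)
  rewrite -(@card_affine_mulmx _ _ _ (J *m (col_mx U u)^T) (row_mx 0 (- 1%:M))).
    apply: eq_card => v; rewrite !inE /= -!mulmxA uP eqxx /=.
    rewrite tr_col_mx !mul_mx_row !mulmxA (alternating_skew u v).
    apply/andP/eqP=> [[/eqP-> /eqP->] //|/eq_row_mx[-> /oppr_inj->]].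
    by rewrite !eqxx.
  by rewrite rankM.
rewrite -cardP -sum1_card.
(* The condition [u != 0] is implied by [u J v^T = 1]; it is added so that the sum can be split over
   [u] first. *)
rewrite (eq_bigl (fun uv => (uv.1 \in P :\ 0) && ((uv.1, uv.2) \in hyperbolic_pairs U)));
  last first.
  case=> u v; rewrite [RHS]andbC; case: (boolP (_ \in _)) => //=.
  rewrite !inE /= mulmxA => /and3P[-> _ /eqP uv1]; rewrite andbT; symmetry.
  apply/eqP=> u0; move/matrixP/(_ 0 0)/eqP: uv1.
  by rewrite u0 !mul0mx !mxE eq_sym oner_eq0.
rewrite -(pair_big_dep (mem (P :\ 0))
  (fun u v => (u, v) \in hyperbolic_pairs U) (fun _ _ => 1%N)) /=.
rewrite (eq_bigr (fun=> (#|F| ^ (m - k.*2).-1)%N)); last first.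
  move=> u uP; rewrite -(cardV u uP) -sum1_card; by apply: eq_bigl => v; rewrite inE.
rewrite sum_nat_const; congr (_ * _)%N.
by rewrite [in RHS](cardsD1 0) inE mul0mx eqxx addnC addnK.
Qed.

Lemma card_symp_frames k :
  #|symp_frames k| =
  (\prod_(i < k) ((#|F| ^ (m - i.*2) - 1) * #|F| ^ (m - i.*2).-1))%N.
Proof.
elim: k => [|k IH].
  rewrite big_ord0 (_ : symp_frames 0 = setT).
    by rewrite cardsT card_mx expn0.
  apply/setP=> U; rewrite !inE; by apply/eqP/matrixP => -[].
rewrite big_ord_recr -IH -sum1_card.
pose join (p : 'M[F]_(k.*2, m) * ('rV[F]_m * 'rV[F]_m)) : 'M[F]_(k.+1.*2, m) :=
  col_mx (col_mx p.2.1 p.2.2) p.1 : 'M_(2 + k.*2, m).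
have join_bij : bijective join.
  exists (fun X : 'M[F]_(2 + k.*2, m) =>
    (dsubmx X, (usubmx (usubmx X : 'M_(1 + 1, m)), dsubmx (usubmx X : 'M_(1 + 1, m))))).
    case=> U [u v]; rewrite /join /= !(@col_mxKd _ 2) !(@col_mxKu _ 2).
    by rewrite col_mxKd col_mxKu.
  by move=> X; rewrite /join /= (@vsubmxK _ 1 1) (@vsubmxK _ 2).
rewrite (reindex join) /=; last exact: onW_bij.
rewrite (eq_bigl (fun p => (p.1 \in symp_frames k) && (p.2 \in hyperbolic_pairs p.1)));
  last by case=> U [u v]; rewrite /join symp_framesS.
rewrite -(pair_big_dep (mem (symp_frames k))
  (fun U p => p \in hyperbolic_pairs U) (fun _ _ => 1%N)) /=.
rewrite (eq_bigr (fun=> ((#|F| ^ (m - k.*2) - 1) * #|F| ^ (m - k.*2).-1)%N)); last first.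
  by move=> U UP; rewrite sum1_card card_hyperbolic_pairs.
by rewrite sum_nat_const.
Qed.
End SymplecticBases.

(** * Congruence of alternating forms and the order of the isometry group *)

Section Isometries.
Variables (F : finFieldType).

Definition isometries N (J J' : 'M[F]_N) : {set 'M[F]_N} :=
  [set X | X *m J *m X^T == J'].

Definition symplectic_mx N (J : 'M[F]_N) :=
  (forall x : 'rV_N, x *m J *m x^T = 0) /\ J \in unitmx.

Lemma isometry_unit N (J J' X : 'M[F]_N) :
  J' \in unitmx -> X \in isometries J J' -> X \in unitmx.
Proof.
move=> uJ'; rewrite inE => /eqP e; move: uJ'; rewrite -e !unitmxE !det_mulmx det_tr.
by rewrite !unitrM => /andP[/andP[]].
Qed.

(** For the standard matrix, isometries are by conversion the symplectic frames of full size;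
    reversing the index puts the product in increasing order. *)
Lemma card_isometries_std k (J : 'M[F]_(k.*2)) : symplectic_mx J ->
  #|isometries J (std_symp_mx F k)| =
  (\prod_(1 <= j < k.+1) ((#|F| ^ (2 * j) - 1) * #|F| ^ (2 * j - 1)))%N.
Proof.
case=> altJ uJ; rewrite (card_symp_frames altJ uJ) big_add1 /= big_mkord.
rewrite (reindex_inj rev_ord_inj) /=; apply: eq_bigr => i _.
by rewrite -doubleB subKn // -mul2n !subn1.
Qed.

(** Existence is read off the count, all of whose factors are positive. *)
Lemma exists_isometry_std k (J : 'M[F]_(k.*2)) : symplectic_mx J ->
  exists X, X \in isometries J (std_symp_mx F k).
Proof.
move=> sJ; apply/set0Pn; rewrite -card_gt0 card_isometries_std //.
rewrite big_seq; apply: prodn_cond_gt0 => j; rewrite mem_index_iota => /andP[j0 _].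
have F1 := finNzRing_gt1 F.
by rewrite muln_gt0 subn_gt0 expn_gt0 (ltnW F1) -{1}(expn0 #|F|) ltn_exp2l // muln_gt0 j0.
Qed.

Lemma symplectic_congruent N (J J' : 'M[F]_N) : ~~ odd N ->
  symplectic_mx J -> symplectic_mx J' ->
  exists2 X, X \in isometries J J' & X \in unitmx.
Proof.
(* The equation [N./2.*2 = N] is eliminated so that [N] takes the form [k.*2] in which [std_symp_mx]
   is typed. *)
move=> /even_halfK; move: (N./2) => k eN; move: J J'; case: N / eN => J J' sJ sJ'.
have [X /[dup] iX] := exists_isometry_std sJ.
have [X' /[dup] iX'] := exists_isometry_std sJ'.
have uS := std_symp_mx_unit F k.
have uX := isometry_unit uS iX; have uX' := isometry_unit uS iX'.
rewrite !inE => /eqP e' /eqP e.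
exists (invmx X' *m X); last by rewrite unitmx_mul unitmx_inv uX' uX.
rewrite inE trmx_mul !mulmxA; apply/eqP.
have -> : invmx X' *m X *m J *m X^T = invmx X' *m (X *m J *m X^T) by rewrite !mulmxA.
rewrite e -e' !mulmxA mulVmx // mul1mx -mulmxA -trmx_mul mulVmx //.
by rewrite trmx1 mulmx1.
Qed.

(** Left multiplication by one isometry [P] onto the standard form maps the isometry group of [J]
    bijectively onto the isometries from [J] to the standard form. *)
Lemma card_isometries N (J : 'M[F]_N) : ~~ odd N -> symplectic_mx J ->
  #|isometries J J| =
  (\prod_(1 <= j < N./2.+1) ((#|F| ^ (2 * j) - 1) * #|F| ^ (2 * j - 1)))%N.
Proof.
move=> /even_halfK; move: (N./2) => k eN; move: J; case: N / eN => J sJ.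
rewrite -(card_isometries_std sJ).
have [P iP] := exists_isometry_std sJ.
have uP := isometry_unit (std_symp_mx_unit F k) iP.
rewrite -(card_imset _ (can_inj (mulKmx uP))); apply: eq_card => X.
move: iP; rewrite inE => /eqP eP; apply/imsetP/idP => [[Y]|].
  rewrite !inE => /eqP eY ->; apply/eqP.
  by rewrite -eP -[in RHS]eY trmx_mul !mulmxA.
rewrite inE => /eqP eX; exists (invmx P *m X); last by rewrite mulKVmx.
rewrite inE trmx_mul; apply/eqP.
have -> : invmx P *m X *m J *m (X^T *m (invmx P)^T)
        = invmx P *m (X *m J *m X^T) *m (invmx P)^T by rewrite !mulmxA.
by rewrite eX -eP !mulmxA mulVmx // mul1mx -mulmxA -trmx_mul mulVmx // trmx1 mulmx1.
Qed.

Lemma isometries_conj N (J J' X G : 'M[F]_N) : X \in unitmx ->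
  X \in isometries J J' ->
  (invmx X *m (G *m X) \in isometries J J) = (G \in isometries J' J').
Proof.
move=> uX; rewrite !inE => /eqP eX.
have uXt : X^T \in unitmx by rewrite unitmx_tr.
rewrite -(inj_eq (can_inj (mulKmx uX))) -(inj_eq (can_inj (mulmxK uXt))) eX.
congr (_ == _); rewrite -eX !trmx_mul !mulmxA mulmxV // mul1mx.
by rewrite -[_ *m X^T]mulmxA -trmx_mul mulmxV // trmx1 mulmx1.
Qed.

End Isometries.

Lemma mx_form_inj (F : fieldType) m n (A B : 'M[F]_(m, n)) :
  (forall (x : 'rV_m) (y : 'rV_n), (x *m A *m y^T) 0 0 = (x *m B *m y^T) 0 0) -> A = B.
Proof.
move=> e; apply/matrixP=> i j; have := e (delta_mx 0 i) (delta_mx 0 j).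
by rewrite !trmx_delta -!rowE -!colE !mxE.
Qed.

(** * The symplectic group of a form as a group of matrices *)

Section SpMatrix.
Variable m : nat.
Local Notation N := m.-1.+1.
Implicit Types J : 'M['F_2]_N.

Definition Sp_mx J : {set {'GL_m['F_2]}} :=
  [set g : {'GL_m['F_2]} | GLval g \in isometries J J].

(** Since [J] is invertible, every isometry is invertible, so restricting to the linear group loses
    none. *)
Lemma card_Sp_mx J : symplectic_mx J -> #|Sp_mx J| = #|isometries J J|.
Proof.
move=> [_ uJ]; rewrite -(card_imset _ (@val_inj _ _ {'GL_m['F_2]})); apply: eq_card => X.
apply/imsetP/idP => [[g]|iX]; first by rewrite inE => ig ->.
exists (Sub X (isometry_unit uJ iX) : {'GL_m['F_2]}); last by rewrite SubK.
by rewrite inE SubK.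
Qed.

Lemma Sp_mx_conj J J' : ~~ odd N -> symplectic_mx J -> symplectic_mx J' ->
  exists x, Sp_mx J' = (Sp_mx J :^ x)%g.
Proof.
move=> ev sJ sJ'; have [X iX uX] := symplectic_congruent ev sJ sJ'.
pose x : {'GL_m['F_2]} := Sub X uX.
exists (x^-1)%g; apply/setP=> g.
by rewrite mem_conjgV [RHS]inE [LHS]inE -(isometries_conj _ uX iX).
Qed.

Lemma Sp_matrix (B : {skew_symmetric 'rV['F_2]_N}) :
  Sp B = Sp_mx (matrix_of_form B).
Proof.
set J := matrix_of_form B.
have BE u v : B u v = (u *m J *m v^T) 0 0.
  by rewrite -(matrix_of_formK B) /form_of_matrix map_mx_id // trace_mx11.
have BgE g u v : B (u *m GLval g) (v *m GLval g) =
    (u *m (GLval g *m J *m (GLval g)^T) *m v^T) 0 0.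
  by rewrite BE trmx_mul !mulmxA.
apply/setP=> g; rewrite !inE; apply/forallP/eqP => [e|e u]; last first.
  by apply/forallP=> v; rewrite BgE BE e.
by apply: mx_form_inj => u v; rewrite -BgE -BE (eqP (forallP (e u) v)).
Qed.

Lemma psymplectic_matrix (B : {skew_symmetric 'rV['F_2]_N}) :
  is_psymplectic B -> symplectic_mx (matrix_of_form B).
Proof.
set J := matrix_of_form B; case=> nd _ alt.
have BE u v : B u v = (u *m J *m v^T) 0 0.
  by rewrite -(matrix_of_formK B) /form_of_matrix map_mx_id // trace_mx11.
split=> [x|].
  (* In characteristic 2 skew symmetry does not force [B x x = 0]; this is the last clause of
     [is_psymplectic]. *)
  by apply/rowP=> i; rewrite ord1 -BE mxE alt // pchar_Fp.
rewrite -row_free_unit; apply: inj_row_free => v vJ.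
apply/eqP; rewrite -memv0 -(eqP nd); apply/mem_orthovP => w _.
by rewrite BE vJ mul0mx mxE.
Qed.
Lemma card_Sp (B : {skew_symmetric 'rV['F_2]_N}) :
  ~~ odd N -> is_psymplectic B ->
  #|Sp B| = (\prod_(1 <= j < N./2.+1) ((2 ^ (2 * j) - 1) * 2 ^ (2 * j - 1)))%N.
Proof.
move=> ev /psymplectic_matrix sB.
by rewrite Sp_matrix card_Sp_mx // card_isometries // card_Fp.
Qed.

End SpMatrix.

(** * Arithmetic and the sign character of ['F_2] *)

Lemma addFF2 (x : 'F_2) : x + x = 0.
Proof. by apply: addrr_pchar2; rewrite pchar_Fp. Qed.

Lemma oppmxF2 m n (A : 'M['F_2]_(m, n)) : - A = A.
Proof. by apply/matrixP=> i j; rewrite mxE oppr_pchar2 // pchar_Fp. Qed.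

Lemma F2P (x : 'F_2) : x = 0 \/ x = 1.
Proof. by case: x => -[|[|//]] i; [left|right]; apply/val_inj. Qed.

Lemma F2_neq0 (x : 'F_2) : x != 0 -> x = 1.
Proof. by case: (F2P x) => ->. Qed.

Definition chi (x : 'F_2) : int := if x == 0 then 1 else -1.

Lemma chiD x y : chi (x + y) = chi x * chi y.
Proof. by case: (F2P x) => ->; case: (F2P y) => ->. Qed.

(** * Character sums of linear and quadratic functions *)

Section CharacterSums.
Variable m : nat.
Implicit Types x y z : 'rV['F_2]_m.

Definition dot (a : 'cV['F_2]_m) x : 'F_2 := (x *m a) 0 0.

Lemma dotD a x y : dot a (x + y) = dot a x + dot a y.
Proof. by rewrite /dot mulmxDl mxE. Qed.

Lemma dot0 a : dot a 0 = 0.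
Proof. by rewrite /dot mul0mx mxE. Qed.

(** If [a] has a nonzero entry [j], translation by the [j]-th unit vector changes the sign of the
    sum. *)
Lemma sum_chi_dot a :
  \sum_x chi (dot a x) = if a == 0 then (2 ^ m)%:Z else 0.
Proof.
case: eqP => [->|/eqP a0].
  rewrite (eq_bigr (fun=> 1)) => [|x _]; last by rewrite /dot mulmx0 mxE.
  by rewrite sumr_const card_mx card_Fp // mul1n natz.
have [j aj] : exists j, a j 0 != 0.
  by apply/cV0Pn.
have e1 : dot a (delta_mx 0 j) = 1.
  by rewrite /dot -rowE mxE (F2_neq0 aj).
have : \sum_x chi (dot a x) = - \sum_x chi (dot a x).
  rewrite [LHS](reindex_inj (addIr (delta_mx 0 j))) -sumrN; apply: eq_bigr => x _.
  by rewrite dotD e1 chiD mulrN1.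
by move: (\sum_x _) => S; lia.
Qed.

(** Expand the square over pairs [x], [x + z]. By the polar identity [f x + f (x + z)] is linear in
    [x] up to a constant, so the inner sum vanishes unless [J z^T = 0], that is, [z = 0]. The term
    [f 0] in the identity allows for functions with [f 0 = 1]. *)
Lemma sum_chi_quadratic (f : 'rV['F_2]_m -> 'F_2) (J : 'M_m) :
  J \in unitmx ->
  (forall x y, (x *m J *m y^T) 0 0 = f x + f y + f (x + y) + f 0) ->
  (\sum_x chi (f x)) ^+ 2 = (2 ^ m)%:Z.
Proof.
move=> uJ fJ; rewrite expr2 mulr_suml.
transitivity (\sum_x \sum_z chi (f x + f (x + z))).
  apply: eq_bigr => x _; rewrite (reindex_inj (addrI x)) mulr_sumr.
  by apply: eq_bigr => z _; rewrite chiD.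
rewrite exchange_big /=.
have E z : \sum_x chi (f x + f (x + z)) =
           chi (f z + f 0) * \sum_x chi (dot (J *m z^T) x).
  rewrite mulr_sumr; apply: eq_bigr=> x _; rewrite -chiD /dot mulmxA fJ.
  (* A doubled term, zero in characteristic 2, is inserted so that both sides agree as
     polynomials. *)
  congr chi; rewrite -[LHS]add0r -(addFF2 (f z + f 0)); ring.
rewrite (eq_bigr _ (fun z _ => E z)) (bigD1 0) //= [X in _ + X]big1 => [|z z0];
  rewrite sum_chi_dot.
  by rewrite addr0 trmx0 mulmx0 eqxx addFF2 /chi eqxx mul1r.
case: eqP => [e|_]; last by rewrite mulr0.
case/eqP: z0; apply: trmx_inj; rewrite trmx0.
by rewrite -(mulKmx uJ z^T) e mulmx0.
Qed.

Lemma additive_dot (phi : 'rV['F_2]_m -> 'F_2) :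
  (forall x y, phi (x + y) = phi x + phi y) -> exists a, forall x, phi x = dot a x.
Proof.
move=> phiD; have phi0 : phi 0 = 0 by have := phiD 0 0; rewrite addr0 addFF2.
exists (\col_j phi (delta_mx 0 j)) => x.
rewrite [in LHS](row_sum_delta x) (big_morph phi phiD phi0) /dot mxE.
apply: eq_bigr => j _; rewrite mxE.
by case: (F2P (x 0 j)) => ->; rewrite ?scale0r ?mul0r // scale1r mul1r.
Qed.

End CharacterSums.

(** * The code defined by a quadratic function on the nonzero vectors *)

Section QuadraticCode.
Variables (m n : nat) (H : 'M['F_2]_(m, n)) (f : 'rV['F_2]_m -> 'F_2) (J : 'M['F_2]_m).
Let h i : 'rV['F_2]_m := (col i H)^T.
Hypothesis h_inj : injective h.
Hypothesis h_neq0 : forall i, h i != 0.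
Hypothesis h_onto : forall x : 'rV_m, x != 0 -> exists i, x = h i.
Hypothesis fJ : forall x y, (x *m J *m y^T) 0 0 = f x + f y + f (x + y) + f 0.
Hypothesis uJ : J \in unitmx.
Hypothesis m_ge4 : (4 <= m)%N.

Let K := col_mx H (\row_i f (h i)).

Lemma polar_alternating (x : 'rV_m) : x *m J *m x^T = 0.
Proof.
apply/rowP=> i; rewrite ord1 fJ mxE.
have -> : x + x = 0 by apply/rowP=> j; rewrite !mxE addFF2.
by rewrite addFF2 add0r addFF2.
Qed.

Lemma polar_symplectic : symplectic_mx J.
Proof. by split=> // x; apply: polar_alternating. Qed.

Lemma sum_columns (phi : 'rV['F_2]_m -> int) :
  \sum_i phi (h i) = \sum_x phi x - phi 0.
Proof.
rewrite [in RHS](bigD1 0) //= [RHS]addrC addKr.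
rewrite -(big_imset phi (in2W h_inj)) /=; apply: eq_bigl => x.
apply/imsetP/idP=> [[i _ ->] //|/h_onto[i ->]]; by exists i.
Qed.

(* The sum of [chi] over the nonzero vectors separates linear functions from
   quadratic ones with nondegenerate polarization. *)
Lemma perm_linear_not_quadratic (s : 'S_n) a b e :
  (forall i, dot a (h (s i)) = dot b (h i) + e * f (h i)) -> e = 0.
Proof.
move=> E; case: (F2P e) => // e1; exfalso.
(* Adding a linear function leaves the polarization unchanged. *)
pose g x := dot b x + f x.
have gJ x y : (x *m J *m y^T) 0 0 = g x + g y + g (x + y) + g 0.
  rewrite fJ /g dotD dot0 add0r.
  rewrite -[LHS]add0r -(addFF2 (dot b x + dot b y)); ring.
have sg := sum_chi_quadratic uJ gJ.
have : \sum_i chi (dot a (h (s i))) = \sum_i chi (g (h i)).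
  by apply: eq_bigr => i _; rewrite E e1 mul1r.
rewrite -(reindex_inj (@perm_inj _ s) (P := predT) (F := fun i => chi (dot a (h i)))).
rewrite (sum_columns (fun x => chi (dot a x))) (sum_columns (fun x => chi (g x))).
rewrite sum_chi_dot dot0 /g dot0 add0r {1}/chi eqxx.
move: sg; set S := \sum_x _; move=> sg.
(* With [q = 2 ^ m], [S - chi (f 0)] is [q - 1] or [-1], so [S] is one of [q], [q - 2], [0], [-2];
   then [S ^+ 2 = q] would force [q <= 4]. *)
have : (16 <= 2 ^ m)%N by rewrite (@leq_exp2l 2 4 m).
move: sg; move: (2 ^ m)%N => q; rewrite /chi.
by rewrite expr2; case: ifP => _; case: ifP => _ ? ? ?; nia.
Qed.

Lemma dot_row r (D : 'M['F_2]_(r, m)) j i :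
  (D *m H) j i = dot (row j D)^T (h i).
Proof.
by rewrite /dot -trmx_mul [RHS]mxE -row_mul !mxE; apply: eq_bigr => k _; rewrite !mxE.
Qed.

(** A relation between the rows makes a linear function plus a multiple of [f] vanish on all
    columns; the multiple is zero by the character sums, and the linear function by evaluation at
    unit vectors. *)
Lemma quadratic_code_row_free : row_free K.
Proof.
apply: inj_row_free => u; rewrite -[u]hsubmxK mul_row_col => e.
have col_e i : dot (lsubmx u)^T (h i) + (rsubmx u) 0 0 * f (h i) = 0.
  by move/rowP/(_ i): e; rewrite mxE dot_row row_id [in X in _ + X]mxE big_ord1 !mxE.
have r0 : rsubmx u = 0.
  apply/rowP=> j; rewrite ord1 [RHS]mxE.
  apply: (@perm_linear_not_quadratic 1%g 0 (lsubmx u)^T) => i.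
  by rewrite col_e /dot mulmx0 mxE.
have l0 : lsubmx u = 0.
  apply/rowP=> j; rewrite mxE.
  have [i hi] : exists i, delta_mx 0 j = h i.
    apply: h_onto; apply/rV0Pn; exists j; by rewrite mxE !eqxx.
  by have := col_e i; rewrite r0 [in X in _ + X]mxE mul0r addr0 -hi /dot -rowE !mxE.
by rewrite r0 l0 row_mx0.
Qed.

Lemma mem_code c : (c \in code_of K) =
  (\sum_i c 0 i *: h i == 0) && (\sum_i c 0 i * f (h i) == 0).
Proof.
rewrite inE mul_col_mx col_mx_eq0; congr (_ && _).
  rewrite -(inj_eq (@trmx_inj _ _ _)) trmx_mul trmxK trmx0 mulmx_sum_row.
  by under eq_bigr => i _ do rewrite -tr_col.
have -> : \row_i f (h i) *m c^T = (\sum_i c 0 i * f (h i))%:M.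
  apply/rowP=> j; rewrite ord1 !mxE eqxx mulr1n.
  by apply: eq_bigr => i _; rewrite !mxE mulrC.
by apply/eqP/eqP => [/rowP/(_ 0)|->]; rewrite ?raddf0 // !mxE eqxx mulr1n.
Qed.

Lemma quadratic_code_dim : exists2 V : {vspace 'rV['F_2]_n},
  code_of K = [set c | c \in V] & \dim V = (n - m - 1)%N.
Proof.
pose V := lker (linfun (mulmxr K^T) : 'Hom('rV['F_2]_n, 'rV['F_2]_(m + 1))).
have VE : code_of K = [set c | c \in V].
  apply/setP=> c; rewrite !inE memv_ker lfunE /=.
  by rewrite -(inj_eq (@trmx_inj _ _ _)) trmx_mul trmxK trmx0.
exists V => //.
(* The dimension is found by comparing cardinalities, as powers of 2. *)
apply/eqP; rewrite -(eqn_exp2l _ _ (ltnSn 1)) -{1}(card_Fp (isT : prime 2)) -card_vspace.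
have -> : #|V| = #|[set c : 'rV_n | c *m K^T == 0]|.
  apply: eq_card => c; rewrite !inE -[RHS](inj_eq (@trmx_inj _ _ _)) trmx_mul trmxK trmx0.
  have : c \in code_of K = (c \in V) by rewrite VE inE.
  by rewrite inE => <-.
by rewrite card_ker_mulmx card_Fp // mxrank_tr (eqP quadratic_code_row_free) subnDA.
Qed.

(** For a fixed nonzero [x] the solutions [y] form an affine hyperplane of at least 8 points, more
    than the two excluded values [0] and [x]. With [c = f 0] this produces a codeword of weight
    3. *)
Lemma exists_polar_value (c : 'F_2) : exists x y : 'rV_m,
  [/\ x != 0, y != 0, x != y & (x *m J *m y^T) 0 0 = c].
Proof.
have m_gt0 : (0 < m)%N by apply: leq_trans m_ge4.
pose x : 'rV['F_2]_m := delta_mx 0 (Ordinal m_gt0).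
have x0 : x != 0 by apply/rV0Pn; exists (Ordinal m_gt0); rewrite mxE !eqxx.
pose A := (x *m J)^T.
have rA : \rank A = 1%N.
  rewrite mxrank_tr rank_rV; case: eqP => //= e; case/eqP: x0.
  by rewrite -(mulmxK uJ x) e mul0mx.
have := card_affine_mulmx c%:M rA; rewrite card_Fp // => cardA.
have : ~~ ([set v : 'rV_m | v *m A == c%:M] \subset [set 0; x]).
  apply/negP=> /subset_leq_card; rewrite cardA cards2 => le.
  have : (2 ^ 3 <= 2)%N.
    apply: leq_trans (leq_trans le _); last by case: (_ != _).
    by rewrite leq_exp2l // leq_subRL // (leq_trans _ m_ge4).
  by [].
case/subsetPn=> y; rewrite !inE negb_or => /eqP yA /andP[y0 yx].
exists x, y; split; rewrite // 1?eq_sym //.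
have -> : x *m J *m y^T = (y *m A)^T by rewrite trmx_mul trmxK.
by rewrite yA !mxE eqxx.
Qed.

Lemma supp_sum (V : lmodType 'F_2) (c : 'rV['F_2]_n) (F : 'I_n -> V) :
  \sum_i c 0 i *: F i = \sum_(i in [set j | c 0 j != 0]) F i.
Proof.
rewrite [RHS]big_mkcond; apply: eq_bigr => i _; rewrite inE.
by case: eqP => [->|/eqP/F2_neq0->]; rewrite ?scale0r ?scale1r.
Qed.

(** The word supported on the columns [x], [y], [x + y] is in the code exactly when the polar form
    at [x], [y] equals [f 0]. A word of weight 1 or 2 would give a zero column or two equal columns
    of [H]. *)
Lemma quadratic_code_min_distance : min_distance (code_of K) 3.
Proof.
split.
  have [x [y [x0 y0 xy xJy]]] := exists_polar_value (f 0).
  have xy0 : x + y != 0.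
    by apply: contra xy; rewrite addr_eq0 oppmxF2.
  have [i hi] := h_onto x0; have [j hj] := h_onto y0; have [k hk] := h_onto xy0.
  have ij : i != j by apply: contra xy => /eqP e; rewrite hi hj e.
  have ik : i != k.
    apply: contra y0 => /eqP e; move: hk; rewrite -e -hi => /eqP.
    by rewrite -subr_eq0 addrAC subrr add0r.
  have jk : j != k.
    apply: contra x0 => /eqP e; move: hk; rewrite -e -hj => /eqP.
    by rewrite -subr_eq0 addrK.
  pose S := [set i; j; k].
  pose c : 'rV['F_2]_n := \row_t (t \in S)%:R.
  have cS : [set t | c 0 t != 0] = S.
    by apply/setP=> t; rewrite inE mxE; case: (t \in S).
  have sumS (V : nmodType) (F : 'I_n -> V) : \sum_(t in S) F t = F i + F j + F k.
    rewrite /S -setUA big_setU1 ?inE ?negb_or ?ij ?ik //=.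
    by rewrite big_setU1 ?inE //= big_set1 addrA.
  exists c, 0; rewrite !mem_code; split.
  - rewrite supp_sum cS sumS -hi -hj -hk.
    have -> : x + y + (x + y) = 0 by apply/rowP=> t; rewrite !mxE addFF2.
    have -> : \sum_t c 0 t * f (h t) = f x + f y + f (x + y).
      rewrite hk hi hj -(sumS _ (fun t => f (h t))) -cS.
      exact: (@supp_sum ('F_2)^o c (fun t => f (h t))).
    by move/eqP: xJy; rewrite fJ -subr_eq0 addrK eqxx.
  - rewrite !big1 ?eqxx // => t _; by rewrite mxE ?scale0r ?mul0r.
  - apply/eqP=> c0; have : i \in [set t | c 0 t != 0] by rewrite cS !inE eqxx.
    by rewrite c0 inE mxE eqxx.
  - rewrite subr0 /wt cS /S -setUA cardsU1 cards2 !inE negb_or ij ik jk //.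
move=> x y; set d := x - y.
have d_code : x \in code_of K -> y \in code_of K -> d \in code_of K.
  rewrite !inE => /eqP ex /eqP ey; by rewrite /d linearB /= mulmxBr ex ey subrr.
move=> xC yC; rewrite -subr_eq0 -/d => d0.
have := d_code xC yC; rewrite mem_code supp_sum => /andP[/eqP + _].
rewrite /wt; set S := [set j | _]; move=> sumS.
rewrite ltnNge; apply/negP.
rewrite leq_eqVlt ltnS leq_eqVlt ltnS leqn0.
case/or3P=> [/cards2P[i [j [ij eS]]] | /cards1P[i eS] | ].
- move: sumS; rewrite eS big_setU1 ?inE // big_set1 /= => /eqP; rewrite addr_eq0 oppmxF2.
  by move=> /eqP/h_inj e; case/eqP: ij.
- by move: sumS; rewrite eS big_set1 => /eqP; rewrite (negPf (h_neq0 i)).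
- rewrite cards_eq0 => /eqP eS; case/eqP: d0; apply/rowP=> t; rewrite [RHS]mxE.
  by move/setP/(_ t): eS; rewrite !inE => /negbFE/eqP.
Qed.

Lemma quadratic_linear_code : linear_code (n - m - 1) 3 (code_of K).
Proof.
have [V VE dV] := quadratic_code_dim.
by exists V; split=> //; apply: quadratic_code_min_distance.
Qed.

(** Duality: the columns of [cokermx K] are codewords, and a matrix that kills all of them has its
    rows in the row space of [K]. *)
Lemma perm_code_sub s : s \in code_Aut (code_of K) -> (col_perm s^-1 K <= K)%MS.
Proof.
rewrite inE => /forall_inP Cs; rewrite submxE; apply/eqP/matrixP=> i j.
have /Cs : (col j (cokermx K))^T \in code_of K.
  by rewrite inE trmxK colE mulmxA mulmx_coker mul0mx.
rewrite inE tr_col_perm trmxK mul_row_perm colE mulmxA -colE => /eqP/colP/(_ i).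
by rewrite !mxE.
Qed.

(** Write the permuted [K] as [D *m K] and split [D] into blocks. The character sums force the upper
    right block to be 0 and the lower right one to be 1, so the columns move by [g = D1^T] and [f]
    changes by a linear function, which does not affect the polarization. *)
Lemma code_AutV_isometry s : s \in code_Aut (code_of K) ->
  exists2 g, g \in isometries J J & forall i, h (s^-1%g i) = h i *m g.
Proof.
move=> /perm_code_sub/submxP[D eD].
have := eD; rewrite -[D]submxK mul_block_col /K.
set D1 := ulsubmx D; set D2 := ursubmx D; set D3 := dlsubmx D; set D4 := drsubmx D.
move=> eDD.
have colH j i : (h (s^-1%g i)) 0 j = dot (row j D1)^T (h i) + D2 j 0 * f (h i).
  move/matrixP/(_ (lshift 1 j) i): eDD.
  by rewrite mxE !col_mxEu mxE dot_row [in X in _ + X]mxE big_ord1 !mxE.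
have colf i : f (h (s^-1%g i)) = dot D3^T (h i) + D4 0 0 * f (h i).
  move/matrixP/(_ (rshift m 0) i): eDD.
  rewrite mxE !col_mxEd [LHS]mxE [RHS]mxE dot_row row_id => ->.
  by rewrite [in X in _ + X]mxE big_ord1 [in X in _ + _ * X]mxE.
have D2_0 j : D2 j 0 = 0.
  apply: (@perm_linear_not_quadratic s^-1 (delta_mx j 0) (row j D1)^T) => i.
  by rewrite -colH /dot -colE mxE.
have D4_1 : D4 0 0 = 1.
  (* Otherwise [f] composed with the inverse permutation would be linear on the columns. *)
  case: (F2P (D4 0 0)) => // D40; exfalso; suff /eqP : (1 : 'F_2) = 0 by [].
  apply: (@perm_linear_not_quadratic s D3^T 0) => i.
  have := colf (s i); rewrite permK D40 mul0r addr0 => <-.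
  by rewrite /dot mulmx0 mxE add0r mul1r.
have hD i : h (s^-1%g i) = h i *m D1^T.
  apply/rowP=> j; rewrite colH D2_0 mul0r addr0 /dot [LHS]mxE [RHS]mxE.
  by apply: eq_bigr => k _; rewrite !mxE.
exists D1^T => //; move: hD; move: D1^T => g hD.
have fg x : x != 0 -> f (x *m g) = dot D3^T x + f x.
  by move=> /h_onto[i ->]; rewrite -hD colf D4_1 mul1r.
rewrite inE; apply/eqP/mx_form_inj => x y.
have -> : x *m (g *m J *m g^T) *m y^T = (x *m g) *m J *m (y *m g)^T.
  by rewrite trmx_mul !mulmxA.
(* The relation [fg] holds at nonzero vectors only, so the cases where [x], [y] or [x + y] is zero
   are treated apart. *)
have [->|x0] := eqVneq x 0; first by rewrite !mul0mx.
have [->|y0] := eqVneq y 0; first by rewrite mul0mx trmx0 !mulmx0.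
have [->|xy] := eqVneq x y; first by rewrite !polar_alternating.
have xy0 : x + y != 0 by rewrite addr_eq0 oppmxF2.
rewrite !fJ -mulmxDl !fg // dotD.
move: (dot _ x) (dot _ y) (f x) (f y) (f (x + y)) (f 0) => a b c d e z.
rewrite -[RHS]add0r -(addFF2 (a + b)); ring.
Qed.

Lemma code_Aut_isometry s : s \in code_Aut (code_of K) ->
  exists2 g, g \in isometries J J & forall i, h (s i) = h i *m g.
Proof.
rewrite -groupV => /code_AutV_isometry[g ig e]; exists g => // i.
by rewrite -e invgK.
Qed.

(** As [g] preserves the polarization, the sum of [f] and its composite with [g] is additive, hence
    some [dot a]. Permuting the columns of [K] by [s] is then a row operation on [K], which
    preserves its kernel. *)
Lemma isometry_code_Aut (s : 'S_n) g : g \in isometries J J ->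
  (forall i, h (s i) = h i *m g) -> s \in code_Aut (code_of K).
Proof.
rewrite inE => /eqP gJ e.
have phiD x y : f ((x + y) *m g) + f (x + y) =
   (f (x *m g) + f x) + (f (y *m g) + f y).
  have := fJ (x *m g) (y *m g).
  have -> : (x *m g) *m J *m (y *m g)^T = x *m (g *m J *m g^T) *m y^T.
    by rewrite trmx_mul !mulmxA.
  rewrite gJ fJ -mulmxDl.
  move: (f x) (f y) (f (x + y)) (f 0) (f (x *m g)) (f (y *m g))
    (f ((x + y) *m g)) => b d q z a c p /eqP.
  rewrite -subr_eq0 => /eqP E; apply/eqP; rewrite -subr_eq0; apply/eqP.
  (* The goal is the relation [E] up to sign and doubled terms, which vanish. *)
  transitivity ((q + q) - (a + a) - (c + c) - (b + d + q + z - (a + c + p + z))).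
    by ring.
  by rewrite E !addFF2 !subr0.
have [a ea] := additive_dot phiD.
(* Passing to the inverse makes [s] itself act on the columns of [K]. *)
rewrite -groupV inE; apply/forall_inP=> c; rewrite !inE tr_col_perm mul_row_perm invgK.
move=> /eqP Kc.
suff -> : col_perm s K = block_mx g^T 0 a^T 1%:M *m K by rewrite -mulmxA Kc mulmx0.
rewrite mul_block_col mul0mx addr0 mul1mx.
apply/matrixP=> i j; rewrite mxE; case: (split_ordP i) => {}i ->.
  rewrite !col_mxEu.
  have := e j => /rowP/(_ i); rewrite !mxE => ->.
  by apply: eq_bigr => k _; rewrite !mxE mulrC.
rewrite !col_mxEd ord1 [LHS]mxE -/(h _) e [RHS]mxE dot_row row_id trmxK -ea.
by rewrite [in X in _ + X]mxE -addrA addFF2 addr0.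
Qed.

End QuadraticCode.

(** * The action of the linear group on the columns, and the isomorphism *)

Section ColumnAction.
Variables (m' n : nat).
(** In this form [m.-1.+1], the matrix size in [{'GL_m['F_2]}], is convertible to [m]. *)
Let m := m'.+1.
Variables (H : 'M['F_2]_(m, n)) (f : 'rV['F_2]_m -> 'F_2) (J : 'M['F_2]_m).
Let h i : 'rV['F_2]_m := (col i H)^T.
Hypothesis h_inj : injective h.
Hypothesis h_neq0 : forall i, h i != 0.
Hypothesis h_onto : forall x : 'rV_m, x != 0 -> exists i, x = h i.
Hypothesis fJ : forall x y, (x *m J *m y^T) 0 0 = f x + f y + f (x + y) + f 0.
Hypothesis uJ : J \in unitmx.
Hypothesis m_ge4 : (4 <= m)%N.

Implicit Types g : {'GL_m['F_2]}.

(** The default [i] is never reached: an invertible matrix sends a column to a nonzero vector, which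
    is again a column. *)
Definition gl_fun g i := odflt i [pick j | h j == h i *m GLval g].

Lemma gl_funE g i : h (gl_fun g i) = h i *m GLval g.
Proof.
rewrite /gl_fun; case: pickP => [j /eqP // | no_j].
have : h i *m GLval g != 0.
  apply: contra (h_neq0 i) => /eqP e.
  by rewrite -(mulmxK (valP g : GLval g \in unitmx) (h i)) e mul0mx.
by case/h_onto=> j ej; have := no_j j; rewrite -ej eqxx.
Qed.

Lemma gl_fun_inj g : injective (gl_fun g).
Proof.
move=> i j e; apply: h_inj; apply: (can_inj (mulmxK (valP g : GLval g \in unitmx))).
by rewrite -!gl_funE e.
Qed.

Definition gl_perm g : 'S_n := perm (@gl_fun_inj g).

Lemma gl_permE g i : h (gl_perm g i) = h i *m GLval g.
Proof. by rewrite permE gl_funE. Qed.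

Lemma gl_permM : {in [set: {'GL_m['F_2]}] &, {morph gl_perm : x y / (x * y)%g}}.
Proof.
move=> x y _ _; apply/permP=> i; apply: h_inj; rewrite permM !gl_permE.
by rewrite GL_MxE mulmxA.
Qed.

Canonical gl_perm_morphism := Morphism gl_permM.

(** The unit vectors occur among the columns, so the permutation determines every row of the
    matrix. *)
Lemma injm_gl_perm : ('injm gl_perm)%g.
Proof.
apply/injmP => x y _ _ e; apply: val_inj; apply/row_matrixP => i.
rewrite !rowE; have [j ->] : exists j, delta_mx 0 i = h j.
  by apply: h_onto; apply/rV0Pn; exists i; rewrite mxE !eqxx.
by rewrite -!gl_permE e.
Qed.

Lemma gl_perm_Sp :
  (gl_perm @* @Sp_mx m J)%g = code_Aut (code_of (col_mx H (\row_i f (h i)))).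
Proof.
apply/setP=> s; apply/morphimP/idP => [[g _ + ->]|].
  by rewrite inE => ig; apply: (isometry_code_Aut fJ ig) => i; apply: gl_permE.
case/(code_Aut_isometry h_inj h_neq0 h_onto fJ uJ m_ge4) => X iX e.
exists (Sub X (isometry_unit uJ iX) : {'GL_m['F_2]}).
- by rewrite inE.
- by rewrite inE SubK.
by apply/permP=> i; apply: h_inj; rewrite gl_permE SubK -e.
Qed.

(** The group of [B] is conjugate to that of the polarization of [f], which [gl_perm] carries
    isomorphically onto the automorphism group. *)
Lemma isog_code_Aut (B : {skew_symmetric 'rV['F_2]_m.-1.+1}) : ~~ odd m ->
  is_psymplectic B ->
  code_Aut (code_of (col_mx H (\row_i f (h i)))) \isog Sp B.
Proof.
move=> ev /psymplectic_matrix sB.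
have [x ex] := @Sp_mx_conj m _ _ ev sB (polar_symplectic fJ uJ).
rewrite isog_sym /= -gl_perm_Sp ex -Sp_matrix.
apply: isog_trans (conj_isog _ x) _.
exact: sub_isog (subsetT _) injm_gl_perm.
Qed.

End ColumnAction.

(** * The columns of the Hamming matrix are the nonzero vectors *)

Section HammingColumns.
Variables (F : fieldExtType 'F_2) (alpha : F) (m n : nat).
Hypotheses (hn : n = (2 ^ m - 1)%N) (hF : \dim {:F} = m).
Hypothesis halpha : n.-primitive_root alpha.

Lemma prim_expr_neq0 i : alpha ^+ i != 0.
Proof.
apply: expf_neq0; apply/eqP=> a0; have /eqP := prim_expr_order halpha.
by rewrite a0 expr0n gtn_eqF ?(prim_order_gt0 halpha) // eq_sym oner_eq0.
Qed.

Lemma prim_expr_inj (i j : 'I_n) : alpha ^+ i = alpha ^+ j -> i = j.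
Proof.
move/eqP; rewrite (eq_prim_root_expr halpha) !modn_small // => /eqP e.
exact: val_inj.
Qed.

Section Coordinates.
Variables (d : nat) (X : d.-tuple F).
Hypothesis spanX : forall i : 'I_n, alpha ^+ i \in <<X>>%VS.

Definition power_coord (i : 'I_n) : 'rV['F_2]_d := \row_j coord X j (alpha ^+ i).

Lemma power_coordK (i : 'I_n) : alpha ^+ i = \sum_j power_coord i 0 j *: X`_j.
Proof. by rewrite {1}(coord_span (spanX i)); apply: eq_bigr => j _; rewrite mxE. Qed.

Lemma power_coord_inj : injective power_coord.
Proof. by move=> i j e; apply: prim_expr_inj; rewrite !power_coordK e. Qed.

Lemma power_coord_neq0 i : power_coord i != 0.
Proof.
apply/eqP=> e; have := prim_expr_neq0 i; rewrite power_coordK e big1 ?eqxx // => j _.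
by rewrite mxE scale0r.
Qed.

Lemma power_coord_sub : [set power_coord i | i : 'I_n] \subset [set~ 0].
Proof. by apply/subsetP=> _ /imsetP[i _ ->]; rewrite !inE power_coord_neq0. Qed.

(** The [n = 2 ^ m - 1] coordinate vectors are distinct and nonzero, so they exhaust the nonzero
    vectors of length [m]. *)
Lemma power_coord_onto : d = m -> forall x : 'rV_d, x != 0 -> exists i, x = power_coord i.
Proof.
move=> dm x x0.
have : x \in [set power_coord i | i : 'I_n].
  have -> : [set power_coord i | i : 'I_n] = [set~ 0]; last by rewrite !inE.
  apply/eqP; rewrite eqEcard power_coord_sub card_imset ?card_ord;
    last exact: power_coord_inj.
  by rewrite cardsC1 card_mx card_Fp // mul1n -subn1 hn dm leqnn.
by case/imsetP=> i _ ->; exists i.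
Qed.

End Coordinates.

(** Each power of [alpha] is a polynomial in [alpha] of degree below that of the extension generated
    by [alpha], which is at most [m]. *)
Lemma span_powers i : alpha ^+ i \in <<[tuple (alpha ^+ k)%R | k < m]>>%VS.
Proof.
have v_in : alpha ^+ i \in <<1; alpha>>%VS by rewrite rpredX // memv_adjoin.
rewrite -(Fadjoin_poly_eq v_in) (@horner_coef_wide _ m); last first.
  apply: leq_trans (size_Fadjoin_poly _ _ _) _.
  by have := dimvS (subvf <<1; alpha>>%VS); rewrite dim_Fadjoin dimv1 muln1 hF.
apply: rpred_sum => k _.
have /polyOverP/(_ k)/vlineP[c ->] := Fadjoin_polyOver 1 alpha (alpha ^+ i).
rewrite -scalerAl mul1r rpredZ // memv_span //.
by apply/tnthP; exists k; rewrite tnth_mktuple.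
Qed.

Let H := Hm m n alpha.

Lemma Hm_colE i : (col i H)^T = power_coord [tuple alpha ^+ k | k < m] i.
Proof. by apply/rowP=> j; rewrite !mxE. Qed.

Lemma Hm_col_inj : injective (fun i => (col i H)^T).
Proof.
move=> i j; rewrite !Hm_colE => /power_coord_inj; apply=> k.
exact: span_powers.
Qed.

Lemma Hm_col_neq0 i : (col i H)^T != 0.
Proof. by rewrite Hm_colE power_coord_neq0 // => k; apply: span_powers. Qed.

Lemma Hm_col_onto (x : 'rV_m) : x != 0 -> exists i, x = (col i H)^T.
Proof.
move=> x0; have [||i ->] := @power_coord_onto m [tuple alpha ^+ k | k < m] _ _ x x0 => //.
  by move=> k; apply: span_powers.
by exists i; rewrite Hm_colE.
Qed.

End HammingColumns.

(** * Hamming weights modulo 4 and their polarization *)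

Section Weights.
Variable m : nat.
Implicit Types x y : 'rV['F_2]_m.

Definition weight_indicator (i1 i2 w : nat) : bool :=
  (w == i1 %[mod 4]) || (w == i2 %[mod 4]).

Lemma wt_sum x : wt x = (\sum_j (x 0 j != 0)%R)%N.
Proof.
rewrite /wt -sum1dep_card big_mkcond; apply: eq_bigr => j _.
by case: (_ != _).
Qed.

Definition overlap x y := (\sum_j ((x 0 j != 0)%R && (y 0 j != 0)%R))%N.

Lemma wtD x y : (wt (x + y) + 2 * overlap x y = wt x + wt y)%N.
Proof.
rewrite !wt_sum big_distrr -!big_split; apply: eq_bigr => j _; rewrite mxE.
by case: (F2P (x 0 j)) => ->; case: (F2P (y 0 j)) => ->.
Qed.

Lemma natr_wt x : (wt x)%:R = \sum_j x 0 j.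
Proof.
rewrite wt_sum natr_sum; apply: eq_bigr => j _.
by case: (F2P (x 0 j)) => ->.
Qed.

Lemma natr_overlap x y : (overlap x y)%:R = \sum_j x 0 j * y 0 j.
Proof.
rewrite natr_sum; apply: eq_bigr => j _.
by case: (F2P (x 0 j)) => ->; case: (F2P (y 0 j)) => ->; rewrite ?mulr0 ?mul0r ?mulr1.
Qed.

Definition weight_polar_mx : 'M['F_2]_m := const_mx 1 + 1%:M.

Lemma weight_polar_mxE x y :
  (x *m weight_polar_mx *m y^T) 0 0 = (wt x * wt y + overlap x y)%:R.
Proof.
rewrite natrD natrM !natr_wt natr_overlap /weight_polar_mx mulmxDr mulmx1 mulmxDl mxE.
congr (_ + _); last by rewrite mxE; apply: eq_bigr => j _; rewrite mxE.
rewrite mxE mulr_sumr; apply: eq_bigr => j _; rewrite !mxE; congr (_ * _).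
by apply: eq_bigr => k _; rewrite mxE mulr1.
Qed.

(** For even [m] the all-ones matrix squares to zero, so this matrix is its own inverse in
    characteristic 2. *)
Lemma weight_polar_mx_unit : ~~ odd m -> weight_polar_mx \in unitmx.
Proof.
move=> ev; suff /mulmx1_unit[] : weight_polar_mx *m weight_polar_mx = 1%:M by [].
rewrite /weight_polar_mx mulmxDr mulmx1 mulmxDl mul1mx.
have -> : (const_mx 1 : 'M['F_2]_m) *m (const_mx 1 : 'M_m) = 0.
  apply/matrixP=> i j; rewrite !mxE (eq_bigr (fun=> 1)) => [|k _];
    last by rewrite !mxE mulr1.
  by rewrite sumr_const card_ord -(even_halfK ev) -mul2n mulrnA mulr2n addFF2 mul0rn.
by rewrite add0r addrA -{1}[const_mx 1]oppmxF2 addNr add0r.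
Qed.

Lemma natrF2_odd k : k%:R = (odd k)%:R :> 'F_2.
Proof. by rewrite -{1}(odd_double_half k) -addnn !natrD addFF2 addr0. Qed.

Lemma natrF2_addb (b c : bool) : b%:R + c%:R = (b (+) c)%:R :> 'F_2.
Proof. by case: b; case: c; rewrite ?addFF2 ?addr0 ?add0r. Qed.

(** Both sides depend only on [a], [b], [i1], [i2] modulo 4 and [e] modulo 2, which leaves a finite
    check. *)
Lemma weight_indicator_polar_nat i1 i2 a b c e : odd (i1 + i2) ->
  (c + 2 * e = a + b)%N ->
  odd (a * b + e) = weight_indicator i1 i2 a (+) weight_indicator i1 i2 b
     (+) weight_indicator i1 i2 c (+) weight_indicator i1 i2 0.
Proof.
(* Modulo 4, [c = a + b - 2 * e] is [a + b + 2 * e], which avoids truncated subtraction. *)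
pose T r s t j1 j2 := odd (j1 + j2) ==> (odd (r * s + t) ==
  weight_indicator j1 j2 r (+) weight_indicator j1 j2 s
  (+) weight_indicator j1 j2 ((r + s + 2 * t) %% 4) (+) weight_indicator j1 j2 0).
have allT : all (fun r => all (fun s => all (fun t => all (fun j1 => all (T r s t j1)
  (iota 0 4)) (iota 0 4)) (iota 0 2)) (iota 0 4)) (iota 0 4) by vm_compute.
move=> oi ec.
have lt4 k : (k %% 4)%N \in iota 0 4 by rewrite mem_iota ltn_mod.
have lt2 k : (k %% 2)%N \in iota 0 2 by rewrite mem_iota ltn_mod.
have := allT => /allP/(_ _ (lt4 a))/allP/(_ _ (lt4 b))/allP/(_ _ (lt2 e))
  /allP/(_ _ (lt4 i1))/allP/(_ _ (lt4 i2)).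
rewrite /T /weight_indicator !modn_mod.
have -> : ((a %% 4 + b %% 4 + 2 * (e %% 2)) %% 4 = c %% 4)%N by lia.
have -> : odd (i1 %% 4 + i2 %% 4) by lia.
have -> : odd (a %% 4 * (b %% 4) + e %% 2) = odd (a * b + e).
  by rewrite !oddD !oddM !(@odd_mod _ 4) ?(@odd_mod _ 2).
by move=> /eqP.
Qed.

Lemma weight_indicator_polar (i1 i2 : nat) x y : odd (i1 + i2) ->
  let f z : 'F_2 := (weight_indicator i1 i2 (wt z))%:R in
  (x *m weight_polar_mx *m y^T) 0 0 = f x + f y + f (x + y) + f 0.
Proof.
move=> oi f; rewrite weight_polar_mxE natrF2_odd /f !natrF2_addb.
rewrite (weight_indicator_polar_nat oi (wtD x y)).
suff -> : wt (0 : 'rV['F_2]_m) = 0%N by [].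
by rewrite wt_sum big1 // => j _; rewrite mxE eqxx.
Qed.

End Weights.

Theorem theorem2p1 (m n : nat) (F : fieldExtType 'F_2) (alpha : F)
    (i1 i2 : 'I_4) (B : {skew_symmetric 'rV['F_2]_m.-1.+1})
    (hm : (4 <= m)%N) (hm_even : ~~ odd m) (hn : n = (2 ^ m - 1)%N)
    (hF : \dim {:F} = m) (halpha : n.-primitive_root alpha)
    (hi : (i1%:Z - i2%:Z = 1 %[mod 2])%Z)
    (hB : is_psymplectic B) :
  let C := code_of (Hmv m n alpha i1 i2) in
  [/\ linear_code (n - m - 1) 3 C,
      code_Aut C \isog Sp B
    & #|code_Aut C| =
        (\prod_(1 <= j < m./2.+1) ((2 ^ (2 * j) - 1) * 2 ^ (2 * j - 1)))%N].
Proof.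
have oi : odd (i1 + i2) by lia.
case: m => [//|m] in B hm hm_even hn hF hB *.
have h_inj := Hm_col_inj hF halpha; have h_neq0 := Hm_col_neq0 hF halpha.
have h_onto := Hm_col_onto hn hF halpha.
have fJ x y := @weight_indicator_polar m.+1 i1 i2 x y oi.
have uJ := weight_polar_mx_unit hm_even.
(* By conversion the appended row of [C] is the weight indicator evaluated at the columns, so the
   results on quadratic codes apply directly. *)
move=> C; have isoC : code_Aut C \isog Sp B.
  exact: (isog_code_Aut h_inj h_neq0 h_onto fJ uJ hm hm_even hB).
split=> //.
  exact: (quadratic_linear_code h_inj h_neq0 h_onto fJ uJ hm).
rewrite (card_isog isoC); exact: (@card_Sp m.+1 B hm_even hB).
Qed.
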